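(* Let $\kappa$ be a supercompact cardinal. Then for every pathological pre-Hilbert space $X$, the set of those $Y\in[X]^{<\kappa}$ which are sub-inner-product-spaces of $X$ and are pathological is stationary in $[X]^{<\kappa}$.
   Context: The scalar field $K$ is $\mathbb{R}$ or $\mathbb{C}$. A pre-Hilbert space is an inner product space over $K$ which need not be complete; a sub-inner-product-space is a linear subspace with the restricted inner product. An orthonormal basis is an orthonormal subset whose linear span is dense; a pre-Hilbert space is pathological if it has no orthonormal basis. $[X]^{<\kappa}$ is the set of subsets of $X$ of cardinality $<\kappa$; a subset of $[X]^{<\kappa}$ is club if it is cofinal under $\subseteq$ and closed under unions of $\subseteq$-chains of length $<\kappa$, and stationary if it meets every club. *)

(* Defs.v *)
From mathcomp Require Export all_boot all_order all_algebra.
From mathcomp Require Export all_classical all_reals all_analysis.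
From mathcomp Require Export sesquilinear complex.
Export numFieldNormedType.Exports.

Set Implicit Arguments.
Unset Strict Implicit.
Unset Printing Implicit Defensive.

Import Order.TTheory GRing.Theory Num.Theory.
Local Open Scope classical_set_scope.
Local Open Scope card_scope.
Local Open Scope ring_scope.

(* A cardinal is represented by a type [kappa] having that cardinality. *)

Definition card_lt (T U : Type) (A : set T) (B : set U) : Prop :=
  A #<= B /\ ~ (B #<= A).

(* [T]^{<kappa}, also written P_kappa(T) *)
Definition small_subsets (kappa T : Type) : set (set T) :=
  [set A | card_lt A [set: kappa]].
Arguments small_subsets : clear implicits.

(* Chains are nonempty: the empty set need not belong to a club. *)
Definition club (kappa T : Type) (C : set (set T)) : Prop :=
  [/\ C `<=` small_subsets kappa T,
      (forall A, small_subsets kappa T A -> exists2 B, C B & A `<=` B) &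
      (forall F : set (set T), F `<=` C -> F !=set0 -> total_on F subset ->
         card_lt F [set: kappa] -> C (\bigcup_(A in F) A))].

Definition stationary (kappa T : Type) (S : set (set T)) : Prop :=
  S `<=` small_subsets kappa T /\
  forall C : set (set T), club kappa C -> (S `&` C) !=set0.

(* A normal measure on P_kappa(A): a kappa-complete, fine and normal
   ultrafilter on P_kappa(A), viewed as an ultrafilter on the power set of A
   that concentrates on P_kappa(A). *)
Definition normal_measure (kappa A : Type) (U : set_system (set A)) : Prop :=
  [/\ UltraFilter U,
      U (small_subsets kappa A),
      (forall F : set (set (set A)), F `<=` U -> card_lt F [set: kappa] ->
         U (\bigcap_(S in F) S)),
      (forall a : A, U [set P | P a]) &
      (forall f : set A -> A, U [set P | P (f P)] ->
         exists a : A, U [set P | f P = a])].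

(* The textbook first-order definition (Jech, Set Theory, Chapter 20); the
   elementary embeddings j : V -> M of the other usual definition are proper
   classes. *)
Definition supercompact (kappa : Type) : Prop :=
  ~ countable [set: kappa] /\
  forall A : Type, [set: kappa] #<= [set: A] ->
    exists U : set_system (set A), normal_measure kappa U.

(* An inner product space over K for the conjugation theta of K, carrying the
   norm (hence the topology) induced by the inner product. The inner product is
   linear in the first argument and theta-linear in the second one. No
   completeness is assumed. *)
Record preHilbertSpace (K : numFieldType) (theta : K -> K) := PreHilbertSpace {
  carrier :> normedModType K;
  inner : {dot carrier for theta};
  norm_inner : forall x : carrier, `|x| ^+ 2 = inner x x
}.

Section PreHilbert.
Variables (K : numFieldType) (theta : K -> K) (X : preHilbertSpace theta).

Definition linear_subspace (Y : set X) : Prop :=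
  submod_closed [in Y].

Definition linear_span (B : set X) : set X := smallest linear_subspace B.

Definition orthonormal_set (B : set X) : Prop :=
  forall x y : X, B x -> B y -> inner X x y = (x == y)%:R.

(* Y is meant to be a linear subspace; the span of B is dense in Y for the
   topology of Y, which is the one induced by X. *)
Definition orthonormal_basis (Y B : set X) : Prop :=
  [/\ B `<=` Y, orthonormal_set B & Y `<=` closure (linear_span B)].

Definition pathological (Y : set X) : Prop :=
  ~ exists B : set X, orthonormal_basis Y B.

End PreHilbert.

(* Main.v *)
(* Let V be a normal measure on P_kappa(X). Every club C has V-measure one: by
   well-ordered induction, C contains every small set closed under a suitable
   monotone map e from finite subsets of X to C, and a set P that is not closed
   under e contains a finite set F with e F not included in P; by normality F
   is V-almost everywhere constant, against fineness. The same argument,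
   together with |K| < kappa, shows that V-almost every P is a subspace.

   If no subspace in C were pathological, V-almost every P would have an
   orthonormal basis B_P. Take for B the set of those x that lie in B_P for
   V-almost every P; it is orthonormal. Given a neighbourhood N of x, almost
   every P contains a finite subset of B_P whose span meets N; by normality this
   finite set is almost everywhere constant, hence included in B. So B is an
   orthonormal basis of X. *)
Require Import Defs.
From mathcomp Require Import finmap wochoice.
Set Implicit Arguments.
Unset Strict Implicit.
Unset Printing Implicit Defensive.
Import Order.TTheory GRing.Theory Num.Theory.
Local Open Scope classical_set_scope.
Local Open Scope card_scope.
Local Open Scope ring_scope.

(** * Cardinality below [kappa], and well-orders *)

Lemma card_lt_image (kappa T U : Type) (f : T -> U) (A : set T) :
  card_lt A [set: kappa] -> card_lt (f @` A) [set: kappa].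
Proof.
move=> [Ak kA]; split; first exact: card_le_trans (card_image_le f A) Ak.
by move=> kfA; apply: kA; exact: card_le_trans kfA (card_image_le f A).
Qed.

Lemma card_lt_subset (kappa T : Type) (A B : set T) :
  A `<=` B -> card_lt B [set: kappa] -> card_lt A [set: kappa].
Proof.
move=> /subset_card_le AB [Bk kB]; split; first exact: card_le_trans AB Bk.
by move=> kA; apply: kB; exact: card_le_trans kA AB.
Qed.

Lemma card_lt_countable (kappa T : Type) (A : set T) :
  ~ countable [set: kappa] -> countable A -> card_lt A [set: kappa].
Proof.
move=> kN cA; split; last by move=> kA; apply: kN; exact: card_le_trans kA cA.
have /infiniteP Nk : infinite_set [set: kappa].
  by move=> /finite_set_countable.
exact: card_le_trans cA Nk.
Qed.

(** Transitivity comes from the least element of [[:: x; y; z]]: if it is [y] or [z], antisymmetry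
    identifies it with the element before it. *)
Lemma well_order_linear (T : eqType) (R : rel T) :
  well_order R -> [/\ total R, antisymmetric R & transitive R].
Proof.
move=> Rwo; have Rwo' := withinW (A := predT) Rwo.
have Rtot : total R by move=> a b; exact: (wo_chainW Rwo').
have Ranti : antisymmetric R.
  by move=> a b; exact: (wo_chain_antisymmetric Rwo').
split=> // y x z Rxy Ryz.
have [|m [[mxyz mmin] _]] := Rwo [mem [:: x; y; z]].
  by exists x; rewrite !inE eqxx.
have [Rmx Rmy Rmz] : [/\ R m x, R m y & R m z].
  by split; apply: mmin; rewrite !inE eqxx ?orbT.
move: mxyz; rewrite !inE => /or3P[] /eqP mE; subst m => //.
- by rewrite (Ranti x y) // Rxy.
- by rewrite -(Ranti y z) // Ryz.
Qed.

(** * Normal measures: existence, completeness and pressing down *)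

Lemma ultra_dichotomy (T : Type) (U : set_system T) :
  ProperFilter U -> (forall A, U A \/ U (~` A)) -> UltraFilter U.
Proof.
move=> UP UA; split=> // G GP UG; apply/seteqP; split=> // A GA.
have [//|/UG GnA] := UA A.
by have [x []] := filter_ex (filterI GA GnA).
Qed.

(* Restricting a normal measure on [X + kappa] to [X] removes the hypothesis
   that [X] has cardinality at least [kappa]. *)
Lemma supercompact_measure (kappa X : Type) :
  supercompact kappa -> exists V : set_system (set X), normal_measure kappa V.
Proof.
move=> [kN /(_ (X + kappa)%type)[]].
  have /card_eqPle[] :
      [set (inr k : X + kappa) | k in [set: kappa]] #= [set: kappa].
    by apply: inj_card_eq => a b _ _ [].
  by move=> _ /card_le_trans; apply; exact: subset_card_le.
move=> U [UU Uk Uc Uf Un]; pose r (Q : set (X + kappa)) : set X := inl @^-1` Q.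
exists (r @ U); split.
- apply: ultra_dichotomy => A.
  exact: (in_ultra_setVsetC (r @^-1` A) UU).
- change (U (r @^-1` small_subsets kappa X)); apply: filterS Uk => Q [Qk kQ].
  have rQ : r Q #<= Q.
    have /card_eqPle[_] : [set (inl x : X + kappa) | x in r Q] #= r Q.
      by apply: inj_card_eq => a b _ _ [].
    by move=> /card_le_trans; apply; apply: subset_card_le => _ [x Qx <-].
  split; first exact: card_le_trans Qk.
  by move=> kr; apply: kQ; exact: card_le_trans rQ.
- move=> F FU Fk; have := Uc _ _ (card_lt_image (preimage r) Fk).
  rewrite bigcap_image /fmap /= preimage_bigcap; apply.
  by move=> _ [A FA <-]; exact: FU.
- by move=> a; exact: Uf (inl a).
(* The function pressed down takes its values in [inl], so its constant value cannot be [inr k]. *)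
- move=> f rf; have [[a|k] Ua] := Un (fun Q => inl (f (r Q))) rf.
    exists a; change (U [set Q | f (r Q) = a]).
    by apply: filterS Ua => Q [].
  by have [Q] := filter_ex Ua.
Qed.

Section measure.
Variables (kappa : Type) (kN : ~ countable [set: kappa]).
Variables (X : choiceType) (V : set_system (set X)).
Hypothesis nV : normal_measure kappa V.

Let VU : UltraFilter V. Proof. by case: nV. Qed.
#[local] Existing Instance VU.

Lemma measure_bigcap (I : Type) (D : set I) (S : I -> set (set X)) :
  card_lt D [set: kappa] -> (forall i, D i -> V (S i)) ->
  V (\bigcap_(i in D) S i).
Proof.
case: nV => _ _ cV _ _ Dk VS.
have := cV _ _ (card_lt_image S Dk); rewrite bigcap_image; apply.
by move=> _ [i Di <-]; exact: VS.
Qed.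

Lemma measure_countable (I : countType) (S : I -> set (set X)) :
  (forall i, V (S i)) -> V (\bigcap_i S i).
Proof. by move=> VS; apply: measure_bigcap => //; exact: card_lt_countable. Qed.

Lemma measure_small : V (small_subsets kappa X). Proof. by case: nV. Qed.

Lemma measure_fine (a : X) : V [set P | P a]. Proof. by case: nV. Qed.

Lemma measure_sup (c : set X) : small_subsets kappa X c -> V [set P | c `<=` P].
Proof.
move=> ck; apply: filterS (measure_bigcap ck (fun x _ => measure_fine x)).
by move=> P cP x cx; exact: cP.
Qed.

(** Regularity of [kappa] is read off from the measure: almost every [P] is small and includes every
    [c i], hence their union. *)
Lemma small_bigcup (I : Type) (D : set I) (c : I -> set X) :
  card_lt D [set: kappa] -> (forall i, D i -> small_subsets kappa X (c i)) ->
  small_subsets kappa X (\bigcup_(i in D) c i).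
Proof.
move=> Dk ck.
have := measure_bigcap Dk (fun i Di => measure_sup (ck i Di)).
move=> /(filterI measure_small)/filter_ex[P [Pk cP]].
by apply: card_lt_subset Pk => x [i Di cix]; exact: (cP i).
Qed.

(* Any point of the measure one set on which every [D j (f P)] is decided
   provides the value. *)
Lemma measure_constant (J : countType) (T : Type) (D : J -> set T)
    (f : set X -> T) :
  (forall s t, (forall i, D i s <-> D i t) -> s = t) ->
  exists t, V [set P | f P = t].
Proof.
move=> Dsep; pose S i := if pselect (V (f @^-1` D i)) then f @^-1` D i
                         else ~` (f @^-1` D i).
have VS : V (\bigcap_i S i).
  apply: measure_countable => i; rewrite /S; case: pselect => // nV'.
  by have [//|] := in_ultra_setVsetC (f @^-1` D i) VU.
have [P0 SP0] := filter_ex VS; exists (f P0); apply: filterS VS => P SP.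
apply: Dsep => i; move: (SP i I) (SP0 i I); rewrite /S.
by case: pselect => _ /= ? ?; split.
Qed.

(** The length is almost everywhere constant by countable completeness; then each entry is so by
    normality. *)
Lemma measure_press_seq (x0 : X) (l : set X -> seq X) :
  V [set P | forall x, x \in l P -> P x] -> exists l0, V [set P | l P = l0].
Proof.
move=> lP; have [n Vn] : exists n, V [set P | size (l P) = n].
  by apply: (measure_constant (D := fun m k : nat => m = k)) => s t /(_ s)[->].
have /choice[b Vb] (i : 'I_n) : exists a, V [set P | nth x0 (l P) i = a].
  case: nV => _ _ _ _; apply; apply: filterS (filterI lP Vn) => P [/= lPP nP].
  by apply/lPP/mem_nth; rewrite nP.
exists [seq b i | i <- enum 'I_n].
apply: filterS (filterI Vn (measure_countable Vb)) => P [/= nP bP].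
apply: (@eq_from_nth _ x0); first by rewrite size_map size_enum_ord.
move=> i; rewrite nP => ni; rewrite (bP (Ordinal ni)) //.
rewrite (nth_map (Ordinal ni)) ?size_enum_ord //.
by rewrite (nth_ord_enum _ (Ordinal ni)).
Qed.

(** * Clubs have measure one *)

Section club.
Variables (C : set (set X)) (CC : club kappa C).

Lemma club_small : C `<=` small_subsets kappa X. Proof. by case: CC. Qed.

Lemma club_bigcup (I : Type) (D : set I) (c : I -> set X) :
  card_lt D [set: kappa] -> D !=set0 -> (forall i, D i -> C (c i)) ->
  (forall i j, D i -> D j -> c i `<=` c j \/ c j `<=` c i) ->
  C (\bigcup_(i in D) c i).
Proof.
case: CC => _ _ Cc Dk [i0 Di0] Dc ctot.
have := Cc (c @` D); rewrite bigcup_image; apply.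
- by move=> _ [i Di <-]; exact: Dc.
- by exists (c i0), i0.
- by move=> _ _ [i Di <-] [j Dj <-]; exact: ctot.
- exact: card_lt_image.
Qed.

(** A mere choice of a member of [C] above each [F] need not be monotone. Stage [n.+1] at [F]
    swallows stage [n] at all subsets of [F], so the union over the stages is monotone; it lies in
    [C] as the union of a countable chain. *)
Lemma club_monotone_cover : exists e : {fset X} -> set X,
  [/\ forall F, C (e F), forall F, [set` F] `<=` e F &
      forall F G, (F `<=` G)%fset -> e F `<=` e G].
Proof.
have /choice[sup supP] (c : set X) : exists B, small_subsets kappa X c ->
    C B /\ c `<=` B.
  case: (pselect (small_subsets kappa X c)) => [ck|]; last by exists set0.
  by case: CC => _ /(_ _ ck)[B CB cB] _; exists B.
pose e := fix e n (F : {fset X}) : set X :=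
  if n is m.+1 then sup (\bigcup_(G in [set` fpowerset F]) e m G)
  else sup [set` F].
have Fk (T : choiceType) (F : {fset T}) : card_lt [set` F] [set: kappa].
  by apply: card_lt_countable => //; exact/finite_set_countable/finite_fset.
have [eC0 F0] : (forall F, C (e 0%N F)) /\ (forall F, [set` F] `<=` e 0%N F).
  by split=> F; have [] := supP _ (Fk _ F).
have eC n F : C (e n F).
  elim: n F => [|n IH] F; first exact: eC0.
  have [] // := supP (\bigcup_(G in [set` fpowerset F]) e n G).
  by apply: small_bigcup => // G _; exact/club_small/IH.
have eS n F G : (F `<=` G)%fset -> e n F `<=` e n.+1 G.
  move=> FG x ex.
  have [] := supP (\bigcup_(G' in [set` fpowerset G]) e n G').
    by apply: small_bigcup => // G' _; exact/club_small/eC.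
  by move=> _; apply; exists F => //=; rewrite fpowersetE.
have emono m n F : (m <= n)%N -> e m F `<=` e n F.
  move=> /subnK <-; elim: (n - m)%N => //= k IH.
  by apply: subset_trans IH _; exact: eS.
exists (fun F => \bigcup_n e n F); split.
- move=> F; apply: club_bigcup.
  + exact: card_lt_countable.
  + by exists 0%N.
  + by move=> n _; exact: eC.
  + move=> m n _ _.
    by case/orP: (leq_total m n) => /(emono _ _ F); [left|right].
- by move=> F x /F0 ex; exists 0%N.
- by move=> F G FG x [n _ ex]; exists n.+1 => //; exact: eS ex.
Qed.

(** If every [F] is included in [e F], the sets closed under [e] are exactly those equal to their
    hull. *)
Definition hull (e : {fset X} -> set X) (S : set X) : set X :=
  \bigcup_(F in [set F : {fset X} | [set` F] `<=` S]) e F.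

Lemma hull_mono e S T : S `<=` T -> hull e S `<=` hull e T.
Proof. by move=> ST x [F FS ex]; exists F => //= y /FS /ST. Qed.

(* Clubs are closed under chains only, and [hull e S] is a directed union: the
   induction along a well-order of [X] keeps a finite set [F] arbitrary, which
   absorbs the successor steps and leaves only unions of chains. *)
Lemma club_hull (e : {fset X} -> set X) (S : set X) :
  (forall F, C (e F)) ->
  (forall F G, (F `<=` G)%fset -> e F `<=` e G) ->
  small_subsets kappa X S -> C (hull e S).
Proof.
move=> eC emono Sk; have [R Rwo] := well_ordering_principle X.
have [Rtot Ranti Rtrans] := well_order_linear Rwo.
have Rrefl a : R a a by case/orP: (Rtot a a).
pose le x := [set y | S y /\ R y x].
(* For a nonempty initial segment [I] of [S], the hull is the union of the chain of hulls over the
   segments [le x], [x] in [I]. *)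
have step (I : set X) : I `<=` S ->
    (forall x, I x -> le x `<=` I) ->
    (forall x, I x -> forall F : {fset X}, C (hull e (le x `|` [set` F]))) ->
    forall F : {fset X}, C (hull e (I `|` [set` F])).
  move=> IS Idown IC F; have [->|/set0P[x0 Ix0]] := eqVneq I set0.
    rewrite set0U; suff -> : hull e [set` F] = e F by [].
    apply/seteqP; split=> [x [G /= GF ex]|x ex]; last by exists F.
    by apply: emono ex; apply/fsubsetP.
  have -> : hull e (I `|` [set` F]) =
      \bigcup_(x in I) hull e (le x `|` [set` F]).
    apply/seteqP; split; last first.
      move=> y [x Ix]; apply: hull_mono; exact/setSU/Idown.
    move=> y [G /= GIF eG].
    (* Finiteness of [G] gives the bound: [x] is the [R]-largest among [x0] and the elements of [G]
       counted in [I]. *)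
    suff [x Ix Gx] : exists2 x, I x & [set` G] `<=` le x `|` [set` F].
      by exists x => //; exists G.
    have : forall z, z \in (G : seq X) -> I z \/ z \in F by move=> z /GIF.
    rewrite /mkset /=.
    suff H (s : seq X) : (forall z, z \in s -> I z \/ z \in F) ->
        exists2 x, I x & forall z, z \in s -> le x z \/ z \in F.
      by move=> /H[x Ix xP]; exists x => // z /xP.
    elim: s => [_|a s IH sIF]; first by exists x0.
    have [z zs|x Ix xP] := IH; first by apply: sIF; rewrite inE zs orbT.
    have [Ia|Fa] := sIF a (mem_head _ _); last first.
      by exists x => // z; rewrite inE => /predU1P[->|/xP]; [right|].
    case/orP: (Rtot a x) => [Rax|Rxa].
      exists x => // z; rewrite inE => /predU1P[->|/xP //].
      by left; split => //; exact: IS.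
    exists a => // z; rewrite inE => /predU1P[->|/xP[[Sz Rzx]|]].
    - by left; split => //; exact: IS.
    - by left; split => //; exact: Rtrans Rxa.
    - by right.
  apply: club_bigcup.
  - exact: card_lt_subset Sk.
  - by exists x0.
  - by move=> x Ix; exact: IC.
  - move=> x y _ _; case/orP: (Rtot x y) => Rxy; [left|right];
      apply/hull_mono/setSU => z [Sz Rz]; split => //; exact: Rtrans Rxy.
have leC x : S x -> forall F : {fset X}, C (hull e (le x `|` [set` F])).
  apply: contrapT => /not_implyP[Sx xN].
  pose bad := [pred y |
    `[< S y /\ ~ forall F : {fset X}, C (hull e (le y `|` [set` F])) >]].
  have [|m [[/asboolP[Sm mN] mmin] _]] := Rwo bad.
    by exists x; apply/asboolP.
  apply: mN => F.
  (* At a least counterexample [m], the point [m] moves into the finite set; what remains is a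
     segment of points strictly below [m], where the claim holds. *)
  have -> : (le m `|` [set` F] = (le m `\ m) `|` [set` (m |` F)%fset]).
    apply/seteqP; split=> z /=; rewrite !inE.
      move=> [lez|->]; last by right; rewrite orbT.
      by have [->|/eqP zm] := eqVneq z m; [right|left].
    move=> [[]|/predU1P[->|]]; [by left| |by right].
    by left; split.
  apply: step => [y [[]] //|y [[Sy Rym] ym] z [Sz Rzy]|y [[Sy Rym] ym] G].
    split; first by split=> //; exact: Rtrans Rym.
    move=> /= zm; apply: ym; rewrite /= zm in Rzy.
    by apply: Ranti; rewrite Rym.
  apply: contrapT => yN; apply: ym => /=.
  by apply: Ranti; rewrite Rym mmin //; apply/asboolP; split=> // /(_ G).
have := step S (@subset_refl _ _) (fun x _ y => @proj1 _ _) leC fset0.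
by rewrite set_fset0 setU0.
Qed.

Lemma club_measure (x0 : X) : V C.
Proof.
have [//|VnC] := in_ultra_setVsetC C VU.
have [e [eC Fe emono]] := club_monotone_cover.
have /choice[F FP] (P : set X) : exists F : {fset X},
    small_subsets kappa X P -> ~ C P ->
    [set` F] `<=` P /\ ~ e F `<=` P.
  have [Pk|] := pselect (small_subsets kappa X P); last by exists fset0.
  have [|nCP] := pselect (C P); first by exists fset0.
  apply: contrapT => /forallNP PF; apply: nCP.
  suff -> : P = hull e P by exact: club_hull.
  apply/seteqP; split=> [x Px|x [F FP ex]].
    exists [fset x]%fset; last by apply: Fe => /=; rewrite inE.
    by move=> y /=; rewrite inE => /eqP ->.
  apply: contrapT => nPx; apply: (PF F) => _ _.
  by split=> // /(_ _ ex).
have VF : V [set P | [set` F P] `<=` P /\ ~ e (F P) `<=` P].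
  by apply: filterS (filterI measure_small VnC) => P [Pk nCP]; exact: FP.
have [l0 Vl0] : exists l0, V [set P | (F P : seq X) = l0].
  by apply: measure_press_seq x0 _ _; apply: filterS VF => P [].
have [P [/= FP0 _]] := filter_ex (filterI Vl0 VF).
(* The set [e (F P)] is small, so almost every [Q] includes it, while [F Q = F P] and [e (F Q)] is
   not included in [Q]. *)
have := measure_sup (club_small (eC (F P))).
move=> /(filterI Vl0)/(filterI VF)/filter_ex[Q [[_ nQ] [/= FQ eQ]]].
case: nQ; suff -> : F Q = F P by []; apply/fsetP => z.
by rewrite -[LHS]/(z \in enum_fset (F Q)) FQ -FP0.
Qed.
End club.
End measure.

(** * Linear subspaces and finite spans *)

Lemma linear_subspaceP (K : numFieldType) (theta : K -> K)
    (X : preHilbertSpace theta) (Y : set X) :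
  linear_subspace Y <->
  Y 0 /\ forall (a : K) (u v : X), Y u -> Y v -> Y (a *: u + v).
Proof.
split=> [[/set_mem Y0 YD]|[Y0 YD]]; split=> //.
- by move=> a u v /mem_set Yu /mem_set Yv; exact/set_mem/YD.
- exact/mem_set.
- by move=> a u v /set_mem Yu /set_mem Yv; exact/mem_set/YD.
Qed.

Lemma linear_subspace_span (K : numFieldType) (theta : K -> K)
    (X : preHilbertSpace theta) (B : set X) : linear_subspace (linear_span B).
Proof.
apply/linear_subspaceP; split=> [M [/linear_subspaceP[]] //|a u v Bu Bv M MP].
by have [/linear_subspaceP[_ MD] _] := MP; apply: MD; [exact: Bu|exact: Bv].
Qed.

(** The vectors spanned by finite lists from [B] form a linear subspace including [B]; combinations
    are handled by concatenating lists. *)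
Lemma linear_span_seq (K : numFieldType) (theta : K -> K)
    (X : preHilbertSpace theta) (B : set X) (z : X) :
  linear_span B z ->
  exists2 l : seq X, (forall x, x \in l -> B x) & linear_span [set` l] z.
Proof.
pose S := [set z | exists2 l : seq X, (forall x, x \in l -> B x) &
                                      linear_span [set` l] z].
apply: (smallest_sub (X := S)) => [|x Bx]; last first.
  exists [:: x]; first by move=> y; rewrite inE => /eqP ->.
  by apply: sub_gen_smallest => /=; rewrite inE.
have mono (l l' : seq X) : {subset l <= l'} ->
    linear_span [set` l] `<=` linear_span [set` l'].
  by move=> ll'; apply: sub_smallest2r => //; exact: linear_subspace_span.
apply/linear_subspaceP; split=> [|a u v [l lB lu] [l' l'B lv]].
  exists [::] => //.
  by have /linear_subspaceP[] := linear_subspace_span [set` [::] : seq X].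
exists (l ++ l') => [x|]; first by rewrite mem_cat => /orP[/lB|/l'B].
have /linear_subspaceP[_] := linear_subspace_span [set` l ++ l']; apply.
- by apply: mono lu => x xl; rewrite mem_cat xl.
- by apply: mono lv => x xl; rewrite mem_cat xl orbT.
Qed.

(** * Pathological subspaces are stationary *)

(** Through the countable separating family [D], scalar-valued functions are almost everywhere
    constant; this lets the real and complex cases share one proof. *)
Lemma stationary_pathological (kappa : Type) (K : numFieldType)
    (theta : K -> K) (J : countType) (D : J -> set K)
    (X : preHilbertSpace theta) :
  supercompact kappa ->
  (forall a b, (forall j, D j a <-> D j b) -> a = b) ->
  pathological [set: X] ->
  stationary kappa
    [set Y : set X | [/\ small_subsets kappa X Y, linear_subspace Y
                       & pathological Y]].
Proof.
move=> hk Dsep Xpath; split=> [Y []//|C CC].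
have kN := hk.1.
have [V nV] := supercompact_measure X hk.
have VU : UltraFilter V by case: nV.
have VC := club_measure kN nV CC 0.
have Vlin : V [set P | linear_subspace P].
  have [//|Vn] := in_ultra_setVsetC [set P : set X | linear_subspace P] VU.
  (* [w P] holds a scalar and two vectors at which closure fails; fineness supplies [P 0]. *)
  have /choice[w wP] (P : set X) : exists w : K * X * X, P 0 ->
      ~ linear_subspace P -> [/\ P w.1.2, P w.2 & ~ P (w.1.1 *: w.1.2 + w.2)].
    apply: contrapT => /forallNP nw; apply: (nw (0, 0, 0)) => P0 nP.
    exfalso; apply: nP; apply/linear_subspaceP; split=> // a u v Pu Pv.
    by apply: contrapT => nP; apply: (nw (a, u, v)).
  have Vw : V [set P | [/\ P (w P).1.2, P (w P).2 &
                          ~ P ((w P).1.1 *: (w P).1.2 + (w P).2)]].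
    by apply: filterS (filterI (measure_fine nV 0) Vn) => P [P0]; exact: wP.
  have [a Va] := measure_constant kN nV (fun P => (w P).1.1) Dsep.
  have [l Vl] : exists l, V [set P | [:: (w P).1.2; (w P).2] = l].
    apply: (measure_press_seq kN nV 0); apply: filterS Vw => P [Pu Pv _] x.
    by rewrite !inE => /orP[] /eqP ->.
  have [P [/= Pa Pl]] := filter_ex (filterI Va Vl).
  (* The scalar and the vectors being constant, fineness puts their combination in almost every [Q],
     a contradiction. *)
  have Vu := measure_fine nV ((w P).1.1 *: (w P).1.2 + (w P).2).
  have [Q [[/= Ql Qa] [Qu [_ _]]]] :=
    filter_ex (filterI (filterI Vl Va) (filterI Vu Vw)).
  by move: Ql; rewrite -Pl Qa -Pa => -[-> ->].
apply: contrapT => nex.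
have /choice[B BP] (P : set X) : exists B, C P -> linear_subspace P ->
    orthonormal_basis P B.
  have [[CP Pl]|nP] := pselect (C P /\ linear_subspace P); last first.
    by exists set0 => CP Pl; case: nP.
  apply: contrapT => /forallNP nB; apply: nex; exists P; split=> //; split=> //.
    exact: club_small CC _ CP.
  by move=> [B PB]; apply: (nB B).
have VB : V [set P | orthonormal_basis P (B P)].
  by apply: filterS (filterI VC Vlin) => P [CP Pl]; exact: BP.
pose B' := [set x | V [set P | B P x]].
apply: Xpath; exists B'; split=> // [x y Bx By|x _ N Nx].
  have [P [[_ BPo _] [Px Py]]] := filter_ex (filterI VB (filterI Bx By)).
  exact: BPo.
have /choice[l lP] (P : set X) : exists l : seq X, orthonormal_basis P (B P) ->
    P x -> (forall y, y \in l -> B P y) /\ linear_span [set` l] `&` N !=set0.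
  have [[PB Px]|nP] := pselect (orthonormal_basis P (B P) /\ P x); last first.
    by exists [::] => ? ?; case: nP.
  have [_ _ /(_ _ Px _ Nx)[z [/linear_span_seq[l lB lz] Nz]]] := PB.
  by exists l => _ _; split=> //; exists z.
have Vl : V [set P | (forall y, y \in l P -> B P y) /\
                    linear_span [set` l P] `&` N !=set0].
  by apply: filterS (filterI VB (measure_fine nV x)) => P [PB]; exact: lP.
have [l0 Vl0] : exists l0, V [set P | l P = l0].
  apply: (measure_press_seq kN nV 0); apply: filterS (filterI VB Vl).
  by move=> P [[BPP _ _] [lB _]] y /lB /BPP.
have [P [/= Pl [_ [z [lz Nz]]]]] := filter_ex (filterI Vl0 Vl).
exists z; split=> //; move: z lz {Nz}; rewrite Pl.
apply: sub_smallest2r; first exact: linear_subspace_span.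
(* Almost every [Q] has [l Q = l0], so each entry of [l0] lies in [B Q] for almost every [Q], that
   is, in [B']. *)
move=> y /= yl; apply: filterS (filterI Vl0 Vl) => Q [/= Ql [lB _]].
by apply: lB; rewrite Ql.
Qed.

(** * Real and complex scalars *)

Lemma rat_separates (R : realType) (a b : R) :
  (forall q : rat, a < ratr q <-> b < ratr q) -> a = b.
Proof.
move=> ab; apply/eqP; rewrite eq_le; apply/andP; split; rewrite leNgt;
  apply/negP => /rat_in_itvoo[q]; rewrite in_itv /= => /andP[l1 l2].
- by move: l1 => /ab /(lt_trans l2); rewrite ltxx.
- by move: l1 => /ab /(lt_trans l2); rewrite ltxx.
Qed.

Local Open Scope complex_scope.

Theorem theorem6p2 (kappa : Type) (hkappa : supercompact kappa)
    (R : realType) :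
  (forall X : preHilbertSpace (@idfun R),
     pathological [set: X] ->
     stationary kappa
       [set Y : set X | [/\ small_subsets kappa X Y, linear_subspace Y
                          & pathological Y]]) /\
  (forall X : preHilbertSpace (@Num.conj R[i]),
     pathological [set: X] ->
     stationary kappa
       [set Y : set X | [/\ small_subsets kappa X Y, linear_subspace Y
                          & pathological Y]]).
Proof.
split=> X.
  by apply: (stationary_pathological (D := fun q : rat => [set a | a < ratr q]))
    => //; exact: rat_separates.
(* Rational cuts of both parts separate complex numbers; the boolean selects the real or the
   imaginary part. *)
apply: (stationary_pathological (D := fun (j : rat * bool) =>
  [set a | (if j.2 then complex.Re a else complex.Im a) < ratr j.1])) => //.
move=> -[a b] [a' b'] ab.
have aa : a = a' by apply: rat_separates => q; exact: (ab (q, true)).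
by rewrite aa; congr Complex; apply: rat_separates => q; exact: (ab (q, false)).
Qed.
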